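(* Let $m\ge1$ and let $\epsilon=(\epsilon_1,\dots,\epsilon_s)$ be a circular sequence of integers with $\epsilon_i\in\{1,-1\}$ for all $i$. Then $\ell(\Gamma^m_\epsilon)=\sum_{\lambda=1}^m a_\lambda(\epsilon)$.
   Context: Indices are mod $s$. Digraph $\Gamma^m_\epsilon$: vertices $x_{i,t}$, $0\le i\le m-1$, $t\in\{1,\dots,s\}$, some ''marked zero''. If $s=1$: all vertices are marked zero, no edges. If $s\ge2$: for each $t$ let $A_t=\max(\epsilon_t,0)$, $B_t=\max(-\epsilon_{t+1},0)$; for each $j\in\{0,\dots,m-1\}$: if $j\ge\max(A_t,B_t)$ add an edge from $x_{j-A_t,t}$ to $x_{j-B_t,t+1}$ of weight $A_t-B_t$; if $A_t\le j<B_t$ mark $x_{j-A_t,t}$ zero; if $B_t\le j<A_t$ mark $x_{j-B_t,t+1}$ zero. Each connected component is a directed path (linear digraph, possibly a single vertex) or a directed cycle; a linear digraph with no vertex marked zero is a free linear digraph, and $\ell(\Gamma^m_\epsilon)$ is their number. For $\lambda\ge1$, a free linear segment of level $\lambda$ of $\epsilon$ is a run of consecutive entries $\epsilon_a,\dots,\epsilon_b$ ($a\in\{1,\dots,s\}$, $a\le b$, indices mod $s$) with $\epsilon_a=-1$, $\epsilon_b=1$, $\sum_{j=a}^b\epsilon_j=0$, $-\lambda\le\sum_{j=a}^i\epsilon_j<0$ for $a\le i<b$, and $\sum_{j=a}^{i_1}\epsilon_j=-\lambda$ for some $a\le i_1<b$; $a_\lambda(\epsilon)$ is their number. *)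

(* Defs.v *)
From mathcomp Require Import all_boot all_order all_algebra.
Set Implicit Arguments.
Unset Strict Implicit.
Unset Printing Implicit Defensive.
Import Order.TTheory GRing.Theory Num.Theory.
Local Open Scope ring_scope.

(* [weight u v] is only meaningful when [edge u v]. *)
Record digraph := Digraph {
  vertex : finType;
  edge : rel vertex;
  weight : vertex -> vertex -> int;
  marked_zero : pred vertex
}.

Definition adjacent (G : digraph) : rel (vertex G) :=
  [rel u v | edge u v || edge v u].

Definition component (G : digraph) (u : vertex G) : {set vertex G} :=
  [set v | connect (@adjacent G) u v].

Definition components (G : digraph) : {set {set vertex G}} :=
  [set component u | u : vertex G].

(* [zip p (behead p)] lists the consecutive pairs of [p]: the edges inside [C]
   are exactly p_0 -> p_1 -> ... -> p_k, which excludes directed cycles. *)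
Definition linear_digraph (G : digraph) (C : {set vertex G}) : bool :=
  [exists p : #|C|.-tuple (vertex G),
    [&& uniq p, C == [set v in p] &
      [forall u in C, forall v in C,
        edge u v == ((u, v) \in zip p (behead p))]]].

Definition free_linear_digraph (G : digraph) (C : {set vertex G}) : bool :=
  linear_digraph C && [forall v in C, ~~ marked_zero v].

Definition ell (G : digraph) : nat :=
  #|[set C in components G | free_linear_digraph C]|.

(* Circular sequences are indexed from 0: the entries are eps_0, ...,
   eps_(s-1), and the index following [t : 'I_s] is [ordS t]. *)
Definition Apart (s : nat) (eps : s.-tuple int) (t : 'I_s) : nat :=
  `|Num.max (tnth eps t) 0|%N.

Definition Bpart (s : nat) (eps : s.-tuple int) (t : 'I_s) : nat :=
  `|Num.max (- tnth eps (ordS t)) 0|%N.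

(* The pair [(i, t)] is the vertex x_{i,t}. *)
Definition Gamma_edge (m s : nat) (eps : s.-tuple int) : rel ('I_m * 'I_s) :=
  [rel u v : 'I_m * 'I_s | (2 <= s)%N &&
    [exists t : 'I_s, exists j : 'I_m,
      [&& (maxn (Apart eps t) (Bpart eps t) <= j)%N,
          u.2 == t, u.1 == (j - Apart eps t)%N :> nat,
          v.2 == ordS t & v.1 == (j - Bpart eps t)%N :> nat]]].

Definition Gamma_weight (m s : nat) (eps : s.-tuple int)
    (u v : 'I_m * 'I_s) : int :=
  (Apart eps u.2)%:Z - (Bpart eps u.2)%:Z.

Definition Gamma_zero (m s : nat) (eps : s.-tuple int) : pred ('I_m * 'I_s) :=
  [pred v : 'I_m * 'I_s | (s == 1)%N ||
    ((2 <= s)%N &&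
     [exists t : 'I_s, exists j : 'I_m,
        [&& (Apart eps t <= j < Bpart eps t)%N,
            v.2 == t & v.1 == (j - Apart eps t)%N :> nat]
        || [&& (Bpart eps t <= j < Apart eps t)%N,
               v.2 == ordS t & v.1 == (j - Bpart eps t)%N :> nat]])].

Definition Gamma (m s : nat) (eps : s.-tuple int) : digraph :=
  Digraph (@Gamma_edge m s eps) (@Gamma_weight m s eps) (@Gamma_zero m s eps).

Definition centry (s : nat) (eps : s.-tuple int) (i : nat) : int :=
  nth 0 eps (i %% s)%N.

Definition psum (s : nat) (eps : s.-tuple int) (a i : nat) : int :=
  \sum_(a <= j < i.+1) centry eps j.

Definition free_linear_segment (lambda s : nat) (eps : s.-tuple int)
    (a : 'I_s) (b : nat) : bool :=
  [&& (a <= b)%N, centry eps a == -1, centry eps b == 1, psum eps a b == 0,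
      [forall i : 'I_b,
         (a <= i)%N ==> (- lambda%:Z <= psum eps a i < 0)] &
      [exists i : 'I_b, (a <= i)%N && (psum eps a i == - lambda%:Z)]].

(* The bound on [b] loses nothing: see [free_linear_segment_bound]. *)
Definition num_segments (lambda s : nat) (eps : s.-tuple int) : nat :=
  #|[set ab : 'I_s * 'I_(s + s) | free_linear_segment lambda eps ab.1 ab.2]|.

Lemma free_linear_segment_bound (lambda s : nat) (eps : s.-tuple int)
    (a : 'I_s) (b : nat) :
  free_linear_segment lambda eps a b -> (b < a + s)%N && (b < s + s)%N.
Proof.
case/and5P => _ _ _ /eqP sum0 /andP[/forallP neg _].
have s_gt0 : (0 < s)%N by apply: leq_ltn_trans (ltn_ord a).
suff lt_b : (b < a + s)%N.
  by rewrite lt_b (ltn_trans lt_b) // ltn_add2r.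
rewrite ltnNge; apply/negP => le_b.
have negi (i : nat) : (a <= i)%N -> (i < b)%N -> psum eps a i < 0.
  by move=> ai ib; have /implyP/(_ ai)/andP[] := neg (Ordinal ib).
have sb : (s <= b)%N := leq_trans (leq_addl _ _) le_b.
have lt1 : psum eps a (a + s).-1 < 0.
  by apply: negi; rewrite -ltnS prednK ?addn_gt0 ?s_gt0 ?orbT // -addn1 leq_add2l.
have lt2 : psum eps a (b - s) < 0.
  by apply: negi; rewrite ?leq_subRL ?[(s + a)%N]addnC // ltn_subrL s_gt0 (leq_trans s_gt0).
have : psum eps a b < 0; last by rewrite sum0 ltxx.
have -> : psum eps a b = psum eps a (a + s).-1 + psum eps a (b - s).
  rewrite {1}/psum (big_cat_nat (n := (a + s)%N)) ?leq_addr ?leqW //=.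
  rewrite big_addn subSn // /psum prednK ?addn_gt0 ?s_gt0 ?orbT //.
  by congr (_ + _); apply: eq_bigr => i _; rewrite /centry modnDr.
by rewrite -[0]addr0 ltrD.
Qed.

(* Main.v *)
(* In [Gamma] every vertex has at most one successor and one predecessor, so a
   free linear digraph is determined by its source. An unmarked source is a
   vertex of the top row in a column [a] with [eps_a = -1], and following the
   edges from it amounts to following the partial sums of [eps] from [a]: the
   depth below the top row is read off the partial sum. The path is forced
   to stop either at a marked vertex, when the partial sum is about to drop
   below [-m], or in the top row, when the partial sum first returns to [0];
   in the latter case it traces a free linear segment of level at most [m]. *)
Require Import Defs.
From mathcomp Require Import all_boot all_order all_algebra.
From mathcomp Require Import zify.
Import Order.TTheory GRing.Theory Num.Theory.
Local Open Scope ring_scope.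

Set Implicit Arguments.
Unset Strict Implicit.
Unset Printing Implicit Defensive.

(** * Reachability and consecutive pairs in a list *)

Lemma connect_ind (T : finType) (e : rel T) (P : T -> Prop) (x y : T) :
  (forall u v, e u v -> P u -> P v) -> connect e x y -> P x -> P y.
Proof.
move=> eP /connectP[p + ->]; elim: p x => //= z p IHp x /andP[exz ezp] Px.
by apply: IHp => //; apply: eP Px.
Qed.

Lemma mem_zip_behead (T : eqType) (x y : T) (s : seq T) :
  (x, y) \in zip s (behead s) ->
  exists s1 s2, s = s1 ++ x :: y :: s2.
Proof.
case: s => // z s /=; elim: s z => //= w s IHs z.
rewrite inE => /orP[/eqP[-> ->]|/IHs[s1 [s2 ->]]]; first by exists [::], s.
by exists (z :: s1), s2.
Qed.

Lemma zip_behead_mem (T : eqType) (x y : T) (s1 s2 : seq T) :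
  (x, y) \in zip (s1 ++ x :: y :: s2) (behead (s1 ++ x :: y :: s2)).
Proof.
elim: s1 => [|z [|w s1] IHs] /=; first by rewrite inE eqxx.
  by rewrite !inE eqxx orbT.
by rewrite inE IHs orbT.
Qed.

(** * Components with a source, when successors and predecessors are unique *)

Section LinearComponents.

Variable G : digraph.
Implicit Types u v w : vertex G.

Definition source u := [forall v, ~~ edge v u].

Hypothesis edge_fun : forall u v w, edge u v -> edge u w -> v = w.
Hypothesis edge_inj : forall u v w, edge u w -> edge v w -> u = v.

Lemma adjacent_sym : connect_sym (@adjacent G).
Proof. by apply: sym_connect_sym => u v; rewrite /adjacent /= orbC. Qed.

Lemma componentE u v : (v \in component u) = connect (@adjacent G) u v.
Proof. by rewrite inE. Qed.

Lemma component_eq u v : v \in component u -> component v = component u.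
Proof.
rewrite componentE => uv; apply/setP => w; rewrite !componentE.
by rewrite (same_connect adjacent_sym uv).
Qed.

(** A path extended edge by edge from [u] never meets itself: [u] has no predecessor, and any other
    repeated vertex would have two. Its length is thus bounded by the number of vertices. *)
Lemma source_maximal_path u : source u ->
  exists p, [/\ path (@edge G) u p, uniq (u :: p) &
                forall w, ~~ edge (last u p) w].
Proof.
move=> /forallP src_u.
pose P n := exists p, [/\ path (@edge G) u p, uniq (u :: p) & size p = n].
have bound n : P n -> (n < #|vertex G|)%N.
  by case=> p [_ /card_uniqP cardp <-]; rewrite -[_.+1]cardp max_card.
suff step n : P n -> (exists p, [/\ path (@edge G) u p, uniq (u :: p) &
    forall w, ~~ edge (last u p) w]) \/ P n.+1.
  have [] // : (exists p, [/\ path (@edge G) u p, uniq (u :: p) &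
    forall w, ~~ edge (last u p) w]) \/ P #|vertex G|; last first.
    by move/bound; rewrite ltnn.
  elim: #|vertex G| => [|n [|/step]]; [by right; exists [::]|by left|by []].
case=> p [up Up <-].
case: (pickP (@edge G (last u p))) => [w ew|last_u]; last first.
  by left; exists p; split=> // w; rewrite last_u.
right; exists (rcons p w); split; rewrite ?size_rcons ?rcons_path ?up //.
rewrite -rcons_cons rcons_uniq Up andbT inE negb_or.
apply/andP; split.
  by apply: contraTneq ew => ->.
apply/negP => /splitPr w_p; case: w_p up Up ew => p1 p2 + Up.
rewrite cat_path last_cat /= => /and3P[_ e1 _] e2; move: Up.
rewrite -cat_cons cat_uniq => /and3P[_ /hasPn/(_ _ (mem_last w p2))].
by rewrite -(edge_inj e1 e2) /= mem_last.
Qed.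

(** The vertices of a maximal path from [u] are closed under adjacency, because successors and
    predecessors are unique; hence they fill the component. *)
Lemma source_linear u : source u -> linear_digraph (component u).
Proof.
move=> src_u; have [p [up Up maxp]] := source_maximal_path src_u.
have nextP v w : v \in u :: p -> edge v w ->
    exists p1 p2, u :: p = p1 ++ v :: w :: p2.
  move=> v_p vw; case/splitPl: p / v_p up Up maxp => p1 p2 last1.
  rewrite cat_path last_cat last1 => /andP[_].
  case: p2 => [_ _ /(_ w)|z p2 /= /andP[vz _] _ _]; first by rewrite /= vw.
  rewrite (edge_fun vw vz) -cat_cons lastI last1.
  by exists (belast u p1), p2; rewrite -cats1 -catA.
have consecutive_edge p1 v w p2 : u :: p = p1 ++ v :: w :: p2 -> edge v w.
  move=> def_p; have: sorted (@edge G) (u :: p) by [].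
  by rewrite def_p => /cat_sorted2[_ /andP[]].
have compE : component u =i u :: p.
  move=> v; rewrite componentE; apply/idP/idP => [uv|].
    apply: (connect_ind (P := fun w => w \in u :: p) _ uv); last first.
      exact: mem_head.
    move=> {uv}v w /orP[vw|wv] v_p.
      by have [p1 [p2 ->]] := nextP _ _ v_p vw; rewrite mem_cat !inE eqxx !orbT.
    move: v_p; rewrite inE => /predU1P[v_u|v_p].
      by move/forallP/(_ w): src_u; rewrite -v_u wv.
    case/splitPr: p / v_p up {Up maxp nextP consecutive_edge} => p1 p2.
    rewrite cat_path /= => /and3P[_ e1 _].
    by rewrite (edge_inj wv e1) -cat_cons mem_cat mem_last.
  move=> v_p; apply: (@connect_sub _ (@edge G)).
    by move=> x y xy; rewrite connect1 // /adjacent /= xy.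
  by apply: path_connect up _ _.
have sizep : size (u :: p) == #|component u|.
  by rewrite (eq_card compE) (card_uniqP Up).
apply/existsP; exists (Tuple sizep); apply/and3P; split => //=.
  by apply/eqP/setP => v; rewrite compE inE.
apply/forall_inP => v; rewrite compE => v_p; apply/forall_inP => w w_p.
apply/eqP; apply/idP/idP => [vw|]; last first.
  by case/(@mem_zip_behead _ _ _ (u :: p)) => p1 [p2 /consecutive_edge].
have [p1 [p2 def_p]] := nextP _ _ v_p vw.
by rewrite -[p]/(behead (u :: p)) def_p zip_behead_mem.
Qed.

Lemma linear_digraph_seq (C : {set vertex G}) : linear_digraph C ->
  exists p : seq (vertex G), [/\ uniq p, C =i p &
    {in C &, forall u v, edge u v = ((u, v) \in zip p (behead p))}].
Proof.
case/existsP => p /and3P[Up /eqP def_C /forall_inP edgeP].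
exists p; split=> // [v|u v uC vC]; first by rewrite [in LHS]def_C inE.
by have /forall_inP/(_ _ vC)/eqP := edgeP _ uC.
Qed.

(** The head of the list qualifies: a predecessor would lie in the same component, and the head
    would then occur again right after it. *)
Lemma linear_source u : linear_digraph (component u) ->
  exists2 v, v \in component u & source v.
Proof.
case/linear_digraph_seq => p [Up def_C edgeP].
have u_C : u \in component u by rewrite componentE connect0.
case: p => [|v p] in Up def_C edgeP; first by rewrite def_C in u_C.
have v_C : v \in component u by rewrite def_C mem_head.
exists v => //; apply/forallP => w; apply/negP => wv.
have w_C : w \in component u.
  rewrite -(component_eq v_C) componentE connect1 //.
  by rewrite /adjacent /= wv orbT.
have := edgeP _ _ w_C v_C; rewrite wv => /esym.
case/mem_zip_behead => -[|z p1] [p2] [_ def_p].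
  by move: Up; rewrite /= def_p mem_head.
by move: Up; rewrite /= def_p mem_cat !inE eqxx !orbT.
Qed.

Lemma component_source_inj u v :
  source u -> source v -> v \in component u -> u = v.
Proof.
move=> src_u src_v uv.
have [p [_ def_C edgeP]] := linear_digraph_seq (source_linear src_u).
(* Every later entry of [p] has its left neighbour as predecessor. The default of [head] is
   harmless, as [p] contains [w]. *)
have first w : source w -> w \in component u -> w = head w p.
  move=> /forallP src_w w_C; move: (w_C); rewrite {1}def_C => w_p.
  case/splitPr: p / w_p def_C edgeP => p1 p2.
  case/lastP: p1 => // p1 z def_C edgeP.
  have z_C : z \in component u by rewrite def_C mem_cat mem_rcons mem_head.
  have := edgeP _ _ z_C w_C.
  by rewrite cat_rcons zip_behead_mem (negPf (src_w z)).
have u_C : u \in component u by rewrite componentE connect0.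
rewrite (first _ src_u u_C) (first _ src_v uv).
by case: (p) def_C u_C => // -> .
Qed.

Lemma ell_sources :
  ell G = #|[set u | source u & [forall v in component u, ~~ marked_zero v]]|.
Proof.
rewrite /ell -(card_in_imset (f := @component G)).
  apply: eq_card => C; rewrite !inE; apply/andP/imsetP => [[]|[u + ->]].
    case/imsetP => u _ -> /andP[/linear_source[v uv src_v] free].
    by exists v; rewrite ?inE ?src_v (component_eq uv).
  rewrite inE => /andP[src_u free]; split; first exact: imset_f.
  by rewrite /free_linear_digraph source_linear.
move=> u v; rewrite !inE => /andP[src_u _] /andP[src_v _] Cuv.
by apply: component_source_inj => //; rewrite Cuv componentE connect0.
Qed.

End LinearComponents.

(** * Partial sums of a circular sequence of signs *)

Section PartialSums.

Variables (s : nat) (eps : s.-tuple int).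
Hypothesis heps : forall i : 'I_s, tnth eps i = 1 \/ tnth eps i = -1.
Hypothesis s_gt0 : (0 < s)%N.

Lemma centry_modn i : centry eps (i %% s) = centry eps i.
Proof. by rewrite /centry modn_mod. Qed.

Lemma tnth_centry (t : 'I_s) : tnth eps t = centry eps t.
Proof. by rewrite /centry modn_small // (tnth_nth 0). Qed.

Lemma centry_pm i : centry eps i = 1 \/ centry eps i = -1.
Proof.
by have := heps (Ordinal (ltn_pmod i s_gt0)); rewrite tnth_centry centry_modn.
Qed.

Lemma psum_start a : psum eps a a = centry eps a.
Proof. by rewrite /psum big_nat1. Qed.

Lemma psumS a i : (a <= i.+1)%N ->
  psum eps a i.+1 = psum eps a i + centry eps i.+1.
Proof. by move=> ai; rewrite /psum big_nat_recr. Qed.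

Lemma psumD_period a i : (a <= i)%N ->
  psum eps a (s + i) = psum eps a (a + s).-1 + psum eps a i.
Proof.
move=> ai; rewrite {1}/psum (big_cat_nat (n := (a + s)%N)) /=; try lia.
rewrite /psum prednK; last by lia.
congr (_ + _); rewrite big_addn.
have -> : ((s + i).+1 - s = i.+1)%N by lia.
by apply: eq_bigr => k _; rewrite /centry modnDr.
Qed.

(* The partial sums change by a fixed amount over each period, so they cannot
   stay in [[-m, 0)]. *)
Lemma psum_escape (m a : nat) :
  exists2 i, (a <= i)%N & ~~ (- m%:Z <= psum eps a i < 0).
Proof.
(* [m.+1] periods are enough: each contributes the same negative integer, so together they reach at
   most [- m.+1]. *)
have [in_range|] := boolP [forall k : 'I_(a + s * m.+1),
    (a <= k)%N ==> (- m%:Z <= psum eps a k < 0)]; last first.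
  rewrite negb_forall => /existsP[k].
  by rewrite negb_imply => /andP[]; exists k.
have range i : (i < a + s * m.+1)%N -> (a <= i)%N -> - m%:Z <= psum eps a i < 0.
  by move=> lti ai; move/forallP/(_ (Ordinal lti))/implyP: in_range; apply.
have period k : psum eps a (s * k + (a + s).-1) =
    psum eps a (a + s).-1 *+ k.+1.
  elim: k => [|k IHk]; first by rewrite muln0 add0n.
  by rewrite mulnS -addnA psumD_period ?IHk ?mulrS //; lia.
have S_range := range (a + s).-1.
have := range (s * m + (a + s).-1)%N; rewrite period -mulr_natl.
nia.
Qed.

End PartialSums.

(** * Segments of bounded level *)

Section WeakSegments.

Variables (s : nat) (eps : s.-tuple int).

(* A free linear segment of some level at most [m]. *)
Definition weak_segment (m a b : nat) : bool :=
  [&& (a <= b)%N, centry eps a == -1, centry eps b == 1, psum eps a b == 0 &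
      [forall i : 'I_b, (a <= i)%N ==> (- m%:Z <= psum eps a i < 0)]].

Lemma weak_segmentP (m a b : nat) :
  reflect [/\ (a <= b)%N, centry eps a = -1, centry eps b = 1, psum eps a b = 0 &
    forall i, (a <= i < b)%N -> - m%:Z <= psum eps a i < 0]
   (weak_segment m a b).
Proof.
apply: (iffP and5P) => -[ab /eqP ca /eqP cb /eqP S0 h]; split=> //.
- by move=> i /andP[ai ib]; move/forallP/(_ (Ordinal ib))/implyP: h; apply.
- by apply/forallP => i; apply/implyP => ai; apply: h; rewrite ai ltn_ord.
Qed.

Lemma free_linear_segmentE (m : nat) (a : 'I_s) (b : nat) :
  free_linear_segment m eps a b =
  weak_segment m a b && [exists i : 'I_b, (a <= i)%N && (psum eps a i == - m%:Z)].
Proof. by rewrite /free_linear_segment /weak_segment !andbA. Qed.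

Lemma weak_segment0 (a b : nat) : weak_segment 0 a b = false.
Proof.
apply/negP => /weak_segmentP[ab ca cb _ /(_ a)]; rewrite psum_start ca leqnn.
have neq_ab : a <> b by move=> eq_ab; move: cb; rewrite -eq_ab ca.
by lia.
Qed.

Lemma weak_segmentS (m : nat) (a : 'I_s) (b : nat) :
  weak_segment m.+1 a b = weak_segment m a b || free_linear_segment m.+1 eps a b.
Proof.
rewrite free_linear_segmentE.
apply/idP/orP => [w|[|/andP[]//]]; last first.
  case/weak_segmentP=> ab ca cb S0 w; apply/weak_segmentP; split=> // i ai.
  by have := w i ai; lia.
rewrite w /=; case: existsP => [_|h]; [by right | left].
case/weak_segmentP: w => ab ca cb S0 w; apply/weak_segmentP; split=> // i ib.
have ltib : (i < b)%N by lia.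
have := w i ib; suff : psum eps a i <> - m.+1%:Z by lia.
by move=> Si; apply: h; exists (Ordinal ltib); rewrite /= Si eqxx andbT; lia.
Qed.

Lemma weak_segment_disjoint (m : nat) (a : 'I_s) (b : nat) :
  ~~ (weak_segment m a b && free_linear_segment m.+1 eps a b).
Proof.
apply/negP => /andP[/weak_segmentP[_ _ _ _ w]].
rewrite free_linear_segmentE => /andP[_ /existsP[i /andP[ai /eqP Si]]].
by have := w i; rewrite Si; have := ltn_ord i; lia.
Qed.

Lemma weak_segment_bound (m : nat) (a : 'I_s) (b : nat) :
  weak_segment m a b -> (b < s + s)%N.
Proof.
elim: m => [|m IHm]; first by rewrite weak_segment0.
by rewrite weak_segmentS => /orP[/IHm//|/free_linear_segment_bound/andP[]].
Qed.

(** Raising the bound from [m] to [m.+1] adds exactly the segments of level [m.+1], disjointly from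
    the earlier ones; the induction starts from the empty set at [m = 0]. *)
Lemma sum_num_segments (m : nat) :
  (\sum_(1 <= lambda < m.+1) num_segments lambda eps)%N =
  #|[set ab : 'I_s * 'I_(s + s) | weak_segment m ab.1 ab.2]|.
Proof.
elim: m => [|m IHm].
  rewrite big_geq //; apply/esym/eqP; rewrite cards_eq0; apply/eqP/setP => ab.
  by rewrite !inE weak_segment0.
rewrite big_nat_recr //= IHm /num_segments.
rewrite -cardsUI [X in (_ + X)%N](_ : _ = 0%N) ?addn0.
  by apply: eq_card => ab; rewrite !inE weak_segmentS.
apply/eqP; rewrite cards_eq0; apply/eqP/setP => ab; rewrite !inE.
by apply/negbTE/weak_segment_disjoint.
Qed.

(** The end is the first return of the partial sums to 0, so neither end can lie strictly inside the
    other segment. *)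
Lemma weak_segment_inj (m a b b' : nat) :
  weak_segment m a b -> weak_segment m a b' -> b = b'.
Proof.
move=> /weak_segmentP[ab _ _ S0 w] /weak_segmentP[ab' _ _ S0' w'].
by have := w b'; have := w' b; rewrite S0 S0'; lia.
Qed.

End WeakSegments.

(** * The graph of a sequence of at least two signs, and its walks *)

Section Walk.

Variables (m s : nat) (eps : s.+2.-tuple int).
Hypothesis heps : forall i : 'I_s.+2, tnth eps i = 1 \/ tnth eps i = -1.
Let G := Gamma m.+1 eps.
Local Notation c := (centry eps).
Implicit Types u v w : 'I_m.+1 * 'I_s.+2.

Let c_pm i : c i = 1 \/ c i = -1.
Proof. exact: centry_pm. Qed.

Lemma Apart_centry (t : 'I_s.+2) : Apart eps t = (c t == 1)%R :> nat.
Proof. by rewrite /Apart tnth_centry; case: (c_pm t) => ->. Qed.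

Lemma Bpart_centry (t : 'I_s.+2) : Bpart eps t = (c t.+1 == -1)%R :> nat.
Proof.
by rewrite /Bpart tnth_centry /= centry_modn; case: (c_pm t.+1) => ->.
Qed.

(** The witnesses in [Gamma_edge] are forced: [t] is the column of [u], and [j] is the row of [u]
    plus [A_t], as well as the row of [v] plus [B_t]. *)
Lemma Gamma_edgeE u v : @edge G u v =
  [&& v.2 == ordS u.2, (u.1 + (c u.2 == 1)%R == v.1 + (c u.2.+1 == -1)%R)%N &
      (u.1 + (c u.2 == 1)%R < m.+1)%N].
Proof.
rewrite /edge /= /Gamma_edge /=; apply/existsP/and3P => [[t /existsP[j]]|].
  rewrite Apart_centry Bpart_centry => /and5P[le_j /eqP -> /eqP u1 /eqP -> /eqP v1].
  rewrite eqxx u1 v1 !subnK ?eqxx ?ltn_ord //; lia.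
case=> /eqP v2 /eqP uv lt_u; exists u.2; apply/existsP; exists (Ordinal lt_u) => /=.
rewrite Apart_centry Bpart_centry v2 !eqxx /=.
by apply/and3P; split; lia.
Qed.

Lemma Gamma_edge_fun u v w : @edge G u v -> @edge G u w -> v = w.
Proof.
case: u v w => [u1 u2] [v1 v2] [w1 w2]; rewrite !Gamma_edgeE /=.
case/and3P=> /eqP-> /eqP uv _ /and3P[/eqP-> /eqP uw _].
by congr pair; apply/val_inj => /=; lia.
Qed.

Lemma Gamma_edge_inj u v w : @edge G u w -> @edge G v w -> u = v.
Proof.
case: u v w => [u1 u2] [v1 v2] [w1 w2]; rewrite !Gamma_edgeE /=.
case/and3P=> /eqP-> /eqP uv _ /and3P[/eqP/ordS_inj eq2 /eqP uw _].
by subst v2; congr pair; apply/val_inj => /=; lia.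
Qed.

(** Since [A_t] and [B_t] are 0 or 1, a strict inequality between them leaves only [j = 0] and
    forces two equal consecutive signs. *)
Lemma Gamma_zeroP v :
  reflect (v.1 = 0%N :> nat /\
     (c v.2 = -1 /\ c v.2.+1 = -1 \/
      exists t : 'I_s.+2, [/\ v.2 = ordS t, c t = 1 & c t.+1 = 1]))
    (@marked_zero G v).
Proof.
rewrite /marked_zero /= /Gamma_zero /=; apply: (iffP existsP).
  case=> t /existsP[j]; rewrite Apart_centry Bpart_centry.
  case/orP => /and3P[lt_j /eqP v2 /eqP v1]; split; try lia.
    by left; rewrite v2; case: (c_pm t) (c_pm t.+1) lt_j => -> [] -> /=; lia.
  right; exists t; case: (c_pm t) (c_pm t.+1) lt_j => -> [] -> /=;
  first [by split | lia].
case=> v1 [[c1 c2]|[t [v2 c1 c2]]].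
  exists v.2; apply/existsP; exists ord0; rewrite Apart_centry Bpart_centry.
  by rewrite v1 c1 c2 !eqxx.
exists t; apply/existsP; exists ord0; rewrite Apart_centry Bpart_centry.
by rewrite v1 c1 c2 v2 !eqxx.
Qed.

(* An unmarked source lies in the top row: the other sources are the [x_{0,t}]
   with [eps_{t-1} = eps_t = 1], which are marked. *)
Lemma source_unmarked u : source (G := G) u -> ~~ @marked_zero G u ->
  u.1 = ord_max /\ c u.2 = -1.
Proof.
case: u => u1 u2 /forallP src_u /Gamma_zeroP /= unmarked.
pose t := ord_pred u2; have tK : ordS t = u2 by rewrite ord_predK.
have ct : c u2 = c t.+1 by rewrite -tK /= centry_modn.
have no_edge i : (u1 + (c t.+1 == -1)%R)%N <> (i + (c t == 1)%R)%N \/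
    (m < i + (c t == 1)%R)%N.
  have [lt_i|le_i] := ltnP i m.+1; last by right; lia.
  have := src_u (Ordinal lt_i, t); rewrite Gamma_edgeE /= tK eqxx /=.
  by rewrite negb_and => /orP[]; lia.
have ltu := ltn_ord u1; rewrite ct.
case: (c_pm t.+1) (c_pm t) => cS [] cT.
(* The only possible predecessor has row [u1 - 1], [u1], [u1], [u1 + 1] in the four cases. It always
   exists in the second case; in the last two it is missing only when [u1 = m]. *)
- have u0 : u1 <> 0%N :> nat.
    by move=> u0; apply: unmarked; split=> //; right; exists t; rewrite tK.
  have := no_edge u1.-1; rewrite cS cT /=; lia.
- by have := no_edge u1; rewrite cS cT /=; lia.
- have um : u1 = m :> nat by have := no_edge u1; rewrite cS cT /=; lia.
  by split=> //; apply/val_inj.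
- have um : u1 = m :> nat by have := no_edge u1.+1; rewrite cS cT /=; lia.
  by split=> //; apply/val_inj.
Qed.

(** As [B_t = 1] here, an edge into row [m] would need [j = m + 1], which is out of range. *)
Lemma top_source (a : 'I_s.+2) :
  c a = -1 -> source (G := G) (ord_max, a).
Proof.
move=> ca; apply/forallP => -[u1 u2]; rewrite Gamma_edgeE /=.
apply/negP => /and3P[/eqP eq_a /eqP].
have -> : c u2.+1 = -1 by rewrite -ca eq_a /= centry_modn.
by rewrite eqxx /=; lia.
Qed.

(* Following the edges from [x_{m-1,a}], the row index plus [A_i] equals [m]
   plus the partial sum of [eps]. *)
Definition on_walk (a i : nat) v :=
  v.2 = (i %% s.+2)%N :> nat /\
  (v.1 + (c i == 1)%R)%N%:Z = m.+1%:Z + psum eps a i.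

Lemma on_walk_start (a : 'I_s.+2) : c a = -1 -> on_walk a a (ord_max, a).
Proof.
move=> ca; split; rewrite /= ?modn_small // psum_start ca /=; lia.
Qed.

Lemma on_walk_inj a i u v : on_walk a i u -> on_walk a i v -> u = v.
Proof.
case: u v => [u1 u2] [v1 v2] [/= u2i u1i] [/= v2i v1i].
by congr pair; apply/val_inj => /=; lia.
Qed.

Let modn_modS i : ((i %% s.+2).+1 %% s.+2 = i.+1 %% s.+2)%N.
Proof. by rewrite -[(_ %% _).+1]addn1 modnDml addn1. Qed.

(** The index [j] of an edge leaving [u] is its row plus [A_i], that is [m.+1 + psum eps a i]; the
    bound [j < m.+1] thus says that the sum is negative. *)
Lemma on_walk_edge a i u v : (a <= i)%N -> on_walk a i u ->
  @edge G u v <-> psum eps a i < 0 /\ on_walk a i.+1 v.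
Proof.
move=> ai [u2 u1]; rewrite Gamma_edgeE /on_walk psumS ?(leqW ai) //.
have -> : (v.2 == ordS u.2) = (v.2 == (i.+1 %% s.+2)%N :> nat).
  by rewrite -val_eqE /= u2 modn_modS.
have -> : c u.2 = c i by rewrite u2 centry_modn.
have -> : c u.2.+1 = c i.+1.
  by rewrite -centry_modn u2 modn_modS centry_modn.
split=> [/and3P[/eqP v2 /eqP uv lt_u]|[neg [v2 v1]]].
  by split; [|split=> //]; case: (c_pm i.+1) uv => -> /=; lia.
by apply/and3P; split; case: (c_pm i.+1) v1 => -> /=; lia.
Qed.

(** Components are closed under adjacency in both directions, so walks must also be followed
    backwards. *)
Lemma on_walk_edge_pred a i u v : (a <= i)%N -> on_walk a i.+1 v ->
  @edge G u v -> on_walk a i u.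
Proof.
move=> ai [v2 v1]; rewrite Gamma_edgeE => /and3P[/eqP uv2 /eqP uv1 _].
have u2 : u.2 = (i %% s.+2)%N :> nat.
  have: (u.2.+1 == i.+1 %[mod s.+2])%N by rewrite -v2 uv2.
  by rewrite -[u.2.+1]addn1 -[i.+1]addn1 eqn_modDr modn_small // => /eqP.
split=> //; move: v1; rewrite psumS ?(leqW ai) //.
have cu : c u.2 = c i by rewrite u2 centry_modn.
have cv : c u.2.+1 = c i.+1.
  by rewrite -centry_modn u2 modn_modS centry_modn.
by move: uv1; rewrite cu cv; case: (c_pm i.+1) => -> /=; lia.
Qed.

(** The row has to be [m.+1 + psum eps a i], less 1 after an entry 1. In that case the previous sum
    keeps it in range; after an entry -1 the sum is strictly negative. A sum of 0 is allowed so as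
    to reach the end of a segment. *)
Lemma on_walk_exists a i : (a <= i)%N -> c a = -1 ->
  (forall k, (a <= k < i)%N -> - m.+1%:Z <= psum eps a k < 0) ->
  - m.+1%:Z <= psum eps a i <= 0 ->
  exists v, on_walk a i v.
Proof.
move=> ai ca range range_i.
suff [k lt_k eq_k] : exists2 k, (k < m.+1)%N &
    (k + (c i == 1)%R)%N%:Z = m.+1%:Z + psum eps a i.
  by exists (Ordinal lt_k, Ordinal (ltn_pmod i (ltn0Sn s.+1))).
suff : 0 <= m.+1%:Z + psum eps a i - (c i == 1)%:Z < m.+1%:Z.
  by exists (absz (m.+1%:Z + psum eps a i - (c i == 1)%:Z)%R); lia.
have [eq_a|neq_a] := eqVneq a i.
  by rewrite -eq_a psum_start ca /=; lia.
case: i => [|i] in ai range range_i neq_a *; first by lia.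
have := range i; move: range_i; rewrite psumS //.
by case: (c_pm i.+1) => -> /=; lia.
Qed.

Lemma on_walk_component (a : 'I_s.+2) i v : c a = -1 -> (a <= i)%N ->
  (forall k, (a <= k < i)%N -> - m.+1%:Z <= psum eps a k < 0) ->
  on_walk a i v -> v \in component (G := G) (ord_max, a).
Proof.
move=> ca; elim: i v => [|i IHi] v ai range wv.
  have a0 : a = 0%N :> nat by lia.
  have := on_walk_start ca; rewrite [X in on_walk _ X]a0 => /on_walk_inj/(_ wv) <-.
  by rewrite (@componentE G) connect0.
have [eq_a|neq_a] := eqVneq (a : nat) i.+1.
  have := on_walk_start ca; rewrite [X in on_walk _ X]eq_a => /on_walk_inj/(_ wv) <-.
  by rewrite (@componentE G) connect0.
have ai' : (a <= i)%N by lia.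
have range_i := range i.
have [||u wu] := on_walk_exists ai' ca; first by move=> k ki; apply: range; lia.
  by lia.
have uC : u \in component (G := G) (ord_max, a).
  by apply: IHi => // k ki; apply: range; lia.
rewrite (@componentE G) in uC; rewrite (@componentE G); apply: connect_trans uC (connect1 _).
apply/orP; left; apply/(on_walk_edge _ ai' wu); split=> //; lia.
Qed.

(** The walk over the indices from [a] to [b] is closed under adjacency: no edge leaves at [b],
    where the sum is 0, and none enters the source at [a]. *)
Lemma segment_component_unmarked (a : 'I_s.+2) b :
  weak_segment eps m.+1 a b ->
  forall v, v \in component (G := G) (ord_max, a) -> ~~ @marked_zero G v.
Proof.
move=> /weak_segmentP[ab ca cb S0 range] v.
rewrite (@componentE G) => av.
have [i /andP[ai ib] wv] : exists2 i, (a <= i <= b)%N & on_walk a i v.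
  pose P v := exists2 i, (a <= i <= b)%N & on_walk a i v.
  apply: (connect_ind (P := P) _ av); last first.
    by exists (a : nat); [rewrite leqnn | apply: on_walk_start].
  move=> u w /orP[uw|wu] [i /andP[ai ib] wi].
    have [neg wSi] := (on_walk_edge w ai wi).1 uw.
    have neq_b : i <> b by move=> eq_b; rewrite eq_b S0 in neg.
    by exists i.+1 => //; lia.
  have [eq_a|neq_a] := eqVneq (a : nat) i.
    have := on_walk_start ca; rewrite [X in on_walk _ X]eq_a.
    move=> /on_walk_inj/(_ wi) eq_u.
    by have /forallP/(_ w) := top_source ca; rewrite eq_u wu.
  case: i => [|i] in ai ib wi neq_a *; first by lia.
  have ai' : (a <= i)%N by lia.
  by exists i; [lia | apply: on_walk_edge_pred ai' wi wu].
have range_lt k : (a <= k < i)%N -> - m.+1%:Z <= psum eps a k < 0.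
  by move=> ki; apply: range; lia.
have cv : c v.2 = c i by rewrite wv.1 centry_modn.
(* Two entries -1 at row 0 would take the sum from [- m.+1] to a lower value. Two entries 1 would
   put the predecessor on the walk one row below row 0. *)
apply/Gamma_zeroP => -[v0 [[c1 c2]|[t [v2 c1 c2]]]].
  have neq_b : i <> b by move=> eq_b; rewrite cv eq_b cb in c1.
  have cS : c i.+1 = -1 by rewrite -c2 -centry_modn wv.1 -modn_modS !centry_modn.
  have := wv.2; rewrite -cv c1 v0 /= => Si.
  have := psumS eps (leqW ai); rewrite cS => SSi.
  have [eq_b|neq_b'] := eqVneq i.+1 b; first by rewrite -eq_b in S0; lia.
  by have := range i.+1; lia.
have ci : c i = 1 by rewrite -cv v2 /= centry_modn.
have neq_a : (a : nat) <> i by move=> eq_a; rewrite -eq_a ca in ci.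
case: i => [|i] in ai ib wv range_lt cv ci neq_a *; first by lia.
have ai' : (a <= i)%N by lia.
have range_i := range i.
have [||u wu] := on_walk_exists ai' ca; first by move=> k ki; apply: range; lia.
  by lia.
have : @edge G u v by apply/(on_walk_edge _ ai' wu); split=> //; lia.
rewrite Gamma_edgeE v2 v0 => /and3P[/eqP/ordS_inj <-].
by rewrite c1 c2 /=; lia.
Qed.

(** Take the first index where the sums leave [[- m.+1, 0)]. Leaving upwards ends a segment; leaving
    downwards, the walk has just visited a marked vertex of row 0. *)
Lemma unmarked_component_segment (a : 'I_s.+2) : c a = -1 ->
  (forall v, v \in component (G := G) (ord_max, a) -> ~~ @marked_zero G v) ->
  exists b, weak_segment eps m.+1 a b.
Proof.
move=> ca unmarked.
have : exists b, (a <= b)%N && ~~ (- m.+1%:Z <= psum eps a b < 0).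
  by have [b ab escape] := psum_escape eps (ltn0Sn _) m.+1 a; exists b; rewrite ab.
case/ex_minnP => b /andP[ab escape] min_b.
have range k : (a <= k < b)%N -> - m.+1%:Z <= psum eps a k < 0.
  move=> /andP[ak kb]; apply/negPn/negP => esc_k.
  by have := min_b k; rewrite ak esc_k; lia.
have neq_a : (a : nat) <> b.
  by move=> eq_a; move: escape; rewrite -eq_a psum_start ca; lia.
case: b => [|k] in ab escape range neq_a {min_b} *; first by lia.
have ak : (a <= k)%N by lia.
have range_k := range k.
move: escape; rewrite psumS // => escape.
case: (c_pm k.+1) => ck; rewrite ck in escape.
  by exists k.+1; apply/weak_segmentP; split=> //; rewrite psumS // ck; lia.
have range_lt l : (a <= l < k)%N -> - m.+1%:Z <= psum eps a l < 0.
  by move=> lk; apply: range; lia.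
have [|v wv] := on_walk_exists ak ca range_lt; first by lia.
have Sk : psum eps a k = - m.+1%:Z by lia.
(* After an entry 1 at [k], the sum before it would already have been below [- m.+1]. *)
have ck' : c k = -1.
  have [<- //|neq_k] := eqVneq (a : nat) k.
  case: k => [|l] in ak Sk range neq_k {wv range_lt range_k ab escape ck neq_a} *.
    by lia.
  have := range l; move: Sk; rewrite psumS //.
  by case: (c_pm l.+1) => -> //; lia.
have /unmarked/Gamma_zeroP[] := on_walk_component ca ak range_lt wv.
have := wv.2; rewrite ck' Sk /= => v1; split; first by lia.
left; rewrite wv.1 centry_modn; split=> //.
by rewrite -centry_modn modn_modS centry_modn.
Qed.

(** The bijection sends a segment to the top vertex of its starting column; it is injective because
    the start determines the end. *)
Lemma ell_Gamma_segments :
  ell G = #|[set ab : 'I_s.+2 * 'I_(s.+2 + s.+2) |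
              weak_segment eps m.+1 ab.1 ab.2]|.
Proof.
rewrite (ell_sources (G := G) Gamma_edge_fun Gamma_edge_inj).
pose f (ab : 'I_s.+2 * 'I_(s.+2 + s.+2)) : vertex G := (ord_max, ab.1).
rewrite -(card_in_imset (f := f)); last first.
  move=> [a b] [a' b'] /[!inE] /= seg seg' [eq_a]; subst a'.
  by congr pair; apply/val_inj; exact: weak_segment_inj seg seg'.
apply: eq_card => u; rewrite inE; apply/andP/imsetP => [[src_u /forall_inP free]|].
  have [u1 cu] : u.1 = ord_max /\ c u.2 = -1.
    by apply: source_unmarked => //; apply: free; rewrite (@componentE G) connect0.
  have [] := @unmarked_component_segment u.2 cu.
    by rewrite -u1 -surjective_pairing.
  move=> b seg; have ltb := weak_segment_bound seg.
  by exists (u.2, Ordinal ltb); rewrite ?inE // /f -u1 -surjective_pairing.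
case=> -[a b]; rewrite inE /= => seg ->; split; last first.
  by apply/forall_inP/(segment_component_unmarked seg).
by apply: top_source; case/weak_segmentP: seg.
Qed.

End Walk.

(** * The one-entry case and the conclusion *)

Lemma ell_all_marked (G : digraph) :
  (forall v : vertex G, marked_zero v) -> ell G = 0%N.
Proof.
move=> marked; apply/eqP; rewrite cards_eq0; apply/eqP/setP => C; rewrite !inE.
apply/negP => /andP[/imsetP[u _ ->] /andP[_ /forall_inP/(_ u)]].
by rewrite marked componentE connect0 => /(_ isT).
Qed.

Theorem theorem4p11 (m s : nat) (eps : s.-tuple int)
    (hm : (1 <= m)%N) (hs : (1 <= s)%N)
    (heps : forall i : 'I_s, tnth eps i = 1 \/ tnth eps i = -1) :
  ell (Gamma m eps) = (\sum_(1 <= lambda < m.+1) num_segments lambda eps)%N.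
Proof.
rewrite sum_num_segments.
case: m hm => // m _; case: s => [//|[|s]] in eps hs heps *; last first.
  exact: ell_Gamma_segments.
(* For [s = 1] there is no segment either: its first and last entries, -1 and 1, would be the same
   entry. *)
rewrite ell_all_marked //; apply/esym/eqP; rewrite cards_eq0; apply/eqP/setP => ab.
rewrite !inE; apply/negP => /weak_segmentP[_].
by rewrite /centry !modn1 => ->.
Qed.
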